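(* For every finite simple undirected graph $G$ with at least one vertex, the thicket number equals the vinewidth: $\tau(G)=\nu(G)$.
   Context: Thicket of $G=(V,E)$: a finite collection $\mathcal H$ of nonempty subsets of $V$ such that each member induces a connected subgraph of $G$ and any two members intersect. A hitting set of $\mathcal H$ is a vertex set meeting every member; the hitting size $\tau(\mathcal H)$ is the minimum cardinality of a hitting set. The thicket number $\tau(G)$ is the maximum of $\tau(\mathcal H)$ over all thickets of $G$. Vine decomposition of $G$: a pair $(T,\ell)$ where $T$ is a tree and $\ell$ assigns to each node $t$ of $T$ a set $V_t\subseteq V$, such that, writing $T_v=\{t: v\in V_t\}$: (i) for each $v\in V$, $T_v$ is nonempty and induces a connected subtree of $T$; (ii) for each edge $uv\in E$, the subtrees $T_u$ and $T_v$ either share a node or some node of $T_u$ is adjacent in $T$ to some node of $T_v$. Its width is $\max_t|V_t|$, and the vinewidth $\nu(G)$ is the minimum width of a vine decomposition of $G$. *)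

(* Defs.v *)
From Stdlib Require Import ClassicalEpsilon.
From mathcomp Require Import all_boot.
Set Implicit Arguments. Unset Strict Implicit. Unset Printing Implicit Defensive.

Definition simple_graph (V : finType) (e : rel V) : Prop :=
  symmetric e /\ irreflexive e.

Definition restr (V : finType) (e : rel V) (X : {set V}) : rel V :=
  fun x y => [&& x \in X, y \in X & e x y].

(* X induces a connected subgraph (X nonempty is required separately). *)
Definition connected_in (V : finType) (e : rel V) (X : {set V}) : Prop :=
  forall x y, x \in X -> y \in X -> connect (restr e X) x y.

Definition thicket (V : finType) (e : rel V) (H : {set {set V}}) : Prop :=
  (forall X, X \in H -> X != set0 /\ connected_in e X) /\
  (forall X Y, X \in H -> Y \in H -> X :&: Y != set0).

Definition hitting (V : finType) (H : {set {set V}}) (S : {set V}) : bool :=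
  [forall X in H, S :&: X != set0].

(* minimum cardinality of a hitting set (the default #|V| is never smaller
   than the true minimum when one exists, since any hitting set has size <= #|V|) *)
Definition hitting_size (V : finType) (H : {set {set V}}) : nat :=
  \big[minn/#|V|]_(S : {set V} | hitting H S) #|S|.

Definition thicket_holds (V : finType) (e : rel V) (H : {set {set V}}) : bool :=
  if excluded_middle_informative (thicket e H) then true else false.

Definition thicket_number (V : finType) (e : rel V) : nat :=
  \max_(H : {set {set V}} | thicket_holds e H) hitting_size H.

Definition is_tree (T : finType) (r : rel T) : Prop :=
  simple_graph r /\ 0 < #|T| /\
  (forall x y : T, connect r x y) /\
  (forall c : seq T, ~ [&& cycle r c, uniq c & 2 < size c]).

Definition node_set (T V : finType) (l : T -> {set V}) (v : V) : {set T} :=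
  [set t | v \in l t].

Definition vine_decomposition (V : finType) (e : rel V)
    (T : finType) (r : rel T) (l : T -> {set V}) : Prop :=
  is_tree r /\
  (forall v : V, node_set l v != set0 /\ connected_in r (node_set l v)) /\
  (forall u v : V, e u v ->
     exists t, exists t', [/\ t \in node_set l u, t' \in node_set l v &
                              (t == t') || r t t']).

Definition width (T V : finType) (l : T -> {set V}) : nat :=
  \max_(t : T) #|l t|.

Definition has_vine_width (V : finType) (e : rel V) (k : nat) : Prop :=
  exists (T : finType) (r : rel T) (l : T -> {set V}),
    vine_decomposition e r l /\ width l = k.

Definition has_vine_width_b (V : finType) (e : rel V) (k : nat) : bool :=
  if excluded_middle_informative (has_vine_width e k) then true else false.

(* the one-node decomposition with bag V shows the minimum exists *)
Lemma has_vine_width_ex (V : finType) (e : rel V) :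
  exists k, has_vine_width_b e k.
Proof.
exists (\max_(t : unit) #|[set: V]|).
rewrite /has_vine_width_b; case: excluded_middle_informative => // [[]].
exists unit, (fun _ _ => false), (fun _ => [set: V]); split => //.
split.
  split; first by split => // x.
  split; first by rewrite card_unit.
  split; first by move=> [] []; exact: connect0.
  by move=> [|x [|y [|z c]]] //=; case: x y z => [] [] [].
split.
  move=> v; split.
    by apply/set0Pn; exists tt; rewrite inE inE.
  by move=> [] [] _ _; exact: connect0.
move=> u v _; exists tt, tt; split; by rewrite ?inE.
Qed.

Definition vinewidth (V : finType) (e : rel V) : nat :=
  ex_minn (has_vine_width_ex e).

(* Main.v *)
(* [thicket <= vine]: if Y is connected, the nodes whose bag meets Y span a
   subtree; the subtrees of the members of a thicket pairwise intersect, so by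
   the Helly property of trees some bag is a hitting set.

   [vine <= thicket]: following Bellenbaum and Diestel's proof of tree-width
   duality, suppose that every thicket has hitting size at most k, and show by
   downward induction on a thicket H that some vine decomposition has only bags
   of size at most k among those hitting H (then take H empty). Let X be a
   minimum hitting set of H. It suffices to find, for each component C of G - X,
   such a decomposition of G[X u C] with X as a bag, since these can be glued
   along X. If C misses a member of H, two adjacent nodes with bags X and C do.
   Otherwise C |: H is a thicket, and the induction hypothesis gives a
   decomposition which is as desired unless some bag at a node s hits H but
   misses C; it is then restricted to X u C and rerouted so that X is the bag
   at s. *)

Require Import Defs.
From Stdlib Require Import ClassicalEpsilon.
From mathcomp Require Import all_boot.

Set Implicit Arguments.
Unset Strict Implicit.
Unset Printing Implicit Defensive.

(** * Connectivity inside a vertex set *)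

Lemma connect_restrC (T : finType) (r : rel T) (A : {set T}) x y :
  symmetric r -> connect (restr r A) x y = connect (restr r A) y x.
Proof.
by move=> rC; apply: sym_connect_sym => u v; rewrite /restr rC andbCA.
Qed.

Lemma connect_restrS (T : finType) (r : rel T) (A B : {set T}) x y :
  A \subset B -> connect (restr r A) x y -> connect (restr r B) x y.
Proof.
move=> /subsetP sAB; apply: connect_sub => u v /and3P[uA vA ruv].
by apply: connect1; rewrite /restr !sAB.
Qed.

Lemma connect_restr_in (T : finType) (r : rel T) (A : {set T}) x y :
  x \in A -> connect (restr r A) x y -> y \in A.
Proof.
move=> xA /connectP[p]; elim: p x xA => [|z p IH] x xA /= => [_ -> //|].
by case/andP=> /and3P[_ zA _]; apply: IH.
Qed.

Lemma connected_in_component (T : finType) (r : rel T) (A : {set T}) x :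
  symmetric r -> connected_in r [set y | connect (restr r A) x y].
Proof.
move=> rC; set C := [set y | _].
have CP y : y \in C -> connect (restr r C) x y.
  rewrite inE => /connectP[p pp ->].
  have: x \in C by rewrite inE connect0.
  elim: p x @C pp => [|z p IH] x C /=; first by rewrite connect0.
  case/andP=> xz pp xC.
  have zC : z \in C by rewrite inE connect1.
  apply: (connect_trans (y := z)).
    by apply: connect1; rewrite /restr xC zC; case/and3P: xz.
  apply: (connect_restrS _ (IH z pp _)); last by rewrite inE connect0.
  apply/subsetP=> w; rewrite !inE; apply: connect_trans; exact: connect1.
move=> y z yC zC; apply: (connect_trans (y := x)); last exact: CP.
by rewrite connect_restrC //; exact: CP.
Qed.

(** * Trees as connected graphs in which every edge is a bridge *)

Definition edge_del (T : finType) (r : rel T) (a b : T) : rel T :=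
  fun x y => r x y && ~~ ((x == a) && (y == b) || (x == b) && (y == a)).

(** Acyclicity, edge by edge. Unlike cycles given as sequences, this form transfers well along maps
    between graphs. *)
Definition all_bridges (T : finType) (r : rel T) : Prop :=
  forall a b, r a b -> ~ connect (edge_del r a b) a b.

Lemma connect_restr_edge_del (T : finType) (r : rel T) (A : {set T}) a b x y :
  (a \notin A) || (b \notin A) ->
  connect (restr r A) x y -> connect (edge_del r a b) x y.
Proof.
move=> abA; apply: connect_sub => u v /and3P[uA vA ruv]; apply: connect1.
rewrite /edge_del ruv /=; apply: contraTN abA.
by case/orP=> /andP[/eqP <- /eqP <-]; rewrite uA vA.
Qed.

Lemma path_restr (T : finType) (r : rel T) (A : {set T}) x p :
  path r x p -> {subset x :: p <= A} -> path (restr r A) x p.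
Proof.
elim: p x => [//|y p IH] x /= /andP[rxy pp] sA.
rewrite /restr rxy !sA ?inE ?eqxx ?orbT //=; apply: IH => // z zp.
by apply: sA; rewrite inE zp orbT.
Qed.

(** A simple path around the edge [a b] closes up with it to a cycle, of length over 2 because the
    path is neither empty nor that edge itself. *)
Lemma is_tree_bridges (T : finType) (r : rel T) : is_tree r -> all_bridges r.
Proof.
case=> [[rC rI] [_ [_ rN]]] a b rab /connectP[p0 pp0 lp0].
move: lp0; case: (shortenP pp0) => p pp up _ lp.
apply: (rN (a :: p)); rewrite up /= rcons_path -lp rC rab andbT.
apply/andP; split.
  by apply: sub_path pp => x y /andP[].
case: p pp lp {up} => [|c [|d p]] //= => [_ ab|pp cb].
  by rewrite -ab rI in rab.
by rewrite -cb /edge_del !eqxx andbF in pp.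
Qed.

(** On a cycle x, y, z, ... the part from z back to x avoids y, so with the edge yz it bypasses the
    edge yx. *)
Lemma is_tree_of_bridges (T : finType) (r : rel T) :
  simple_graph r -> 0 < #|T| -> (forall x y, connect r x y) ->
  all_bridges r -> is_tree r.
Proof.
move=> rG T0 rT rB; do 3!split=> //; case: rG => rC _.
move=> [|x [|y [|z c]]] /and3P[cc uc] //= _.
move: cc uc => /= /and3P[rxy ryz pz] /and3P[].
rewrite !inE !negb_or => /and3P[xy xz xc] /andP[yz yc] _.
apply: (rB y x); first by rewrite rC.
apply: (connect_trans (y := z)).
  by apply: connect1; rewrite /edge_del ryz eqxx (eq_sym z) (negPf xz) (eq_sym y)
    (negPf xy).
apply: (@connect_restr_edge_del _ _ [set~ y]); first by rewrite !inE eqxx.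
apply/connectP; exists (rcons c x); last by rewrite last_rcons.
apply: path_restr => // w; rewrite !inE mem_rcons inE.
case/or3P=> [/eqP->|/eqP->//|]; first by rewrite eq_sym.
by apply: contraTneq => ->.
Qed.

(** * Subtrees and the Helly property *)

(** If the first step [a c] left [A], that edge could be bypassed: inside [A], which misses [c], to
    the end of the path, then back to [c] along [p], which misses [a]. *)
Lemma tree_path_sub (T : finType) (r : rel T) (A : {set T}) a p :
  is_tree r -> connected_in r A -> a \in A -> last a p \in A ->
  path r a p -> uniq (a :: p) -> {subset a :: p <= A}.
Proof.
move=> rT cA; have rB := is_tree_bridges rT; case: rT => [[rC _] _].
elim: p a => [|c p IH] a aA lA; first by move=> _ _ z; rewrite inE => /eqP->.
move=> /= /andP[rac pp] /andP[ap up].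
suff cinA : c \in A.
  by move=> z; rewrite inE => /orP[/eqP->//|]; apply: IH.
apply/negPn/negP => cA'; apply: (rB a c rac).
apply: (connect_trans (y := last c p)).
  by apply: connect_restr_edge_del (cA _ _ aA lA); rewrite cA' orbT.
apply: (@connect_restr_edge_del _ _ [set~ a]); first by rewrite !inE eqxx.
rewrite connect_restrC //.
apply/connectP; exists p => //; apply: path_restr => // z zp.
by rewrite !inE; apply: contraNneq ap => <-.
Qed.

Lemma path_connected_in (T : finType) (r : rel T) a p :
  symmetric r -> path r a p -> connected_in r [set x in a :: p].
Proof.
move=> rC pp.
have aP y : y \in a :: p -> connect (restr r [set x in a :: p]) a y.
  have: path (restr r [set x in a :: p]) a p.
    by apply: path_restr => // z zp; rewrite inE.
  by move=> /path_connect pr; apply: pr.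
move=> x y; rewrite !inE => xp yp; apply: (connect_trans (y := a)); last exact: aP.
by rewrite connect_restrC //; exact: aP.
Qed.

Lemma tree_path (T : finType) (r : rel T) a b :
  is_tree r -> exists p, [/\ path r a p, uniq (a :: p) & b = last a p].
Proof.
case=> _ [_ [rK _]]; case/connectP: (rK a b) => p0 pp0 ->.
by case: (shortenP pp0) => p pp up _; exists p.
Qed.

(** [M] is the vertex set of a simple path from [a] to [b]. Later proofs use only its minimality
    among subtrees. *)
Lemma tree_segment (T : finType) (r : rel T) a b :
  is_tree r -> exists M : {set T}, [/\ a \in M, b \in M, connected_in r M &
    forall A, connected_in r A -> a \in A -> b \in A -> M \subset A].
Proof.
move=> rT; have [p [pp up bE]] := tree_path a b rT.
exists [set x in a :: p]; rewrite !inE eqxx bE -in_cons mem_last; split=> //.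
  by apply: path_connected_in => //; case: rT => [[]].
move=> A cA aA bA; apply/subsetP=> x; rewrite inE.
exact: (tree_path_sub rT cA).
Qed.

Lemma tree_connected_inI (T : finType) (r : rel T) (A B : {set T}) :
  is_tree r -> connected_in r A -> connected_in r B -> connected_in r (A :&: B).
Proof.
move=> rT cA cB x y /setIP[xA xB] /setIP[yA yB].
have [M [xM yM cM MP]] := tree_segment x y rT.
by apply: (connect_restrS _ (cM _ _ xM yM)); rewrite subsetI !MP.
Qed.

Lemma connected_inU (T : finType) (r : rel T) (A B : {set T}) :
  symmetric r -> connected_in r A -> connected_in r B -> A :&: B != set0 ->
  connected_in r (A :|: B).
Proof.
move=> rC cA cB /set0Pn[a /setIP[aA aB]].
have aP y : y \in A :|: B -> connect (restr r (A :|: B)) a y.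
  case/setUP=> yAB; [apply: connect_restrS (cA _ _ aA yAB); exact: subsetUl|].
  by apply: connect_restrS (cB _ _ aB yAB); exact: subsetUr.
move=> x y xAB yAB; apply: (connect_trans (y := a)); last exact: aP.
by rewrite connect_restrC //; exact: aP.
Qed.

(** The path from [b] to [c] stays in [A] and in the subtree B u C, starts in [C] and ends in [B].
    If it avoids the intersection of [B] and [C], some edge of it leads from C \ B to B \ C. That
    edge is bypassed through a common node of [B] and [C], contradicting that it is a bridge. *)
Lemma tree_helly3 (T : finType) (r : rel T) (A B C : {set T}) :
  is_tree r -> connected_in r A -> connected_in r B -> connected_in r C ->
  A :&: B != set0 -> A :&: C != set0 -> B :&: C != set0 ->
  A :&: B :&: C != set0.
Proof.
move=> rT cA cB cC /set0Pn[c /setIP[cA' cB']] /set0Pn[b /setIP[bA bC]] BC.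
have rB := is_tree_bridges rT; have rC : symmetric r by case: rT => [[]].
have cU := connected_inU rC cB cC BC.
have [a /setIP[aB aC]] := set0Pn _ BC.
have [p [pp up cE]] := tree_path b c rT; rewrite cE in cA' cB'.
have sA := tree_path_sub rT cA bA cA' pp up.
have: {subset b :: p <= B :|: C}.
  by apply: (tree_path_sub rT cU) => //; rewrite inE ?bC ?cB' ?orbT.
elim: p b {bA cE up cA'} bC pp cB' sA => [|d p IH] b bC /=.
  move=> _ bB sA _; apply/set0Pn; exists b.
  by rewrite !inE bC bB sA // inE eqxx.
move=> /andP[rbd pp] lB sA sU.
have bA : b \in A by apply: sA; rewrite inE eqxx.
have [dC|dC] := boolP (d \in C).
  by apply: (IH d) => // z zp; [apply: sA | apply: sU]; rewrite inE zp orbT.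
have dB : d \in B.
  have: d \in B :|: C by apply: sU; rewrite !inE eqxx orbT.
  by rewrite inE (negPf dC) orbF.
have [bB|bB] := boolP (b \in B).
  by apply/set0Pn; exists b; rewrite !inE bA bB.
case: (rB b d rbd); apply: (connect_trans (y := a)).
  by apply: connect_restr_edge_del (cC _ _ bC aC); rewrite dC orbT.
by apply: connect_restr_edge_del (cB _ _ aB dB); rewrite bB.
Qed.

(** Two members are replaced by their intersection; the case of three sets shows that the new family
    still intersects pairwise. *)
Lemma tree_helly (T : finType) (r : rel T) (F : seq {set T}) :
  is_tree r -> {in F, forall A, connected_in r A} ->
  {in F &, forall A B, A :&: B != set0} -> exists t, {in F, forall A : {set T}, t \in A}.
Proof.
move=> rT; have [n] := ubnP (size F); elim: n F => // n IH [|A [|B F]] sF cF iF.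
- by case: rT => _ [/card_gt0P[t _] _]; exists t.
- have /set0Pn[t] := iF A A (mem_head _ _) (mem_head _ _).
  by rewrite setIid => tA; exists t => B; rewrite inE => /eqP->.
have AF : A \in [:: A, B & F] by rewrite !inE eqxx.
have BF : B \in [:: A, B & F] by rewrite !inE eqxx orbT.
have FF C : C \in F -> C \in [:: A, B & F] by rewrite !inE => ->; rewrite !orbT.
have hI C : C \in F -> A :&: B :&: C != set0.
  by move=> CF; apply: (tree_helly3 rT); auto.
case: (IH (A :&: B :: F)) => // [C|C D|t tP].
- rewrite inE => /orP[/eqP->|/FF]; last exact: cF.
  by apply: tree_connected_inI => //; apply: cF.
- rewrite !inE => /orP[/eqP->|CF] /orP[/eqP->|DF].
  + by rewrite setIid iF.
  + exact: hI.
  + by rewrite setIC hI.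
  + by apply: iF; apply: FF.
exists t => C; have /setIP[tA tB] := tP _ (mem_head _ _).
rewrite !inE => /or3P[/eqP->|/eqP->|CF] //.
by apply: tP; rewrite inE CF orbT.
Qed.

(** * Every thicket is hit by a bag *)

(** Along a walk in [Y], the subtrees of consecutive vertices share a node or are joined by a tree
    edge. *)
Lemma connected_in_bags (V T : finType) (e : rel V) (r : rel T)
    (l : T -> {set V}) (Y : {set V}) :
  vine_decomposition e r l -> connected_in e Y ->
  connected_in r [set t | l t :&: Y != set0].
Proof.
case=> rT [lC lE] cY; set TY := [set t | _].
have sTY v : v \in Y -> node_set l v \subset TY.
  move=> vY; apply/subsetP=> t; rewrite !inE => tv.
  by apply/set0Pn; exists v; rewrite inE tv.
move=> t t'; rewrite !inE => /set0Pn[v /setIP[vt vY]] /set0Pn[v' /setIP[vt' vY']].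
have /connectP[p pp v'E] := cY _ _ vY vY'; rewrite {}v'E {v' vY'} in vt'.
elim: p v vY t vt vt' pp => [|w p IH] v vY t vt vt'.
  move=> _; apply: (connect_restrS (sTY v vY)).
  by apply: (lC v).2; rewrite inE.
move=> /= /andP[/and3P[_ wY evw] pp].
have [t1 [t2 [t1v t2w t12]]] := lE _ _ evw.
apply: (connect_trans (y := t1)).
  by apply: (connect_restrS (sTY v vY)); apply: (lC v).2; rewrite // inE.
apply: (connect_trans (y := t2)); last by apply: (IH w) => //; rewrite inE in t2w.
case/orP: t12 => [/eqP->//|r12]; apply: connect1; rewrite /restr r12 andbT.
by rewrite (subsetP (sTY v vY)) // (subsetP (sTY w wY)).
Qed.

Lemma hittingP (V : finType) (H : {set {set V}}) (S : {set V}) :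
  reflect (forall X, X \in H -> S :&: X != set0) (hitting H S).
Proof. exact: forall_inP. Qed.

Lemma thicket_bag_hitting (V T : finType) (e : rel V) (r : rel T)
    (l : T -> {set V}) (H : {set {set V}}) :
  vine_decomposition e r l -> thicket e H -> exists t, hitting H (l t).
Proof.
move=> D [HC HI]; pose f (Y : {set V}) := [set t | l t :&: Y != set0].
have [||t tP] := @tree_helly T r [seq f Y | Y <- enum H] D.1.
- move=> A /mapP[Y]; rewrite mem_enum => YH ->.
  exact: (connected_in_bags D (HC Y YH).2).
- move=> A B /mapP[Y]; rewrite mem_enum => YH -> /mapP[Z].
  rewrite mem_enum => ZH ->.
  (* A bag holding a common vertex of [Y] and [Z] meets both. *)
  have /set0Pn[v /setIP[vY vZ]] := HI Y Z YH ZH.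
  have [/set0Pn[t tv] _] := D.2.1 v; rewrite inE in tv.
  by apply/set0Pn; exists t; rewrite !inE; apply/andP; split;
    apply/set0Pn; exists v; rewrite inE tv.
exists t; apply/hittingP => Y YH.
by have := tP (f Y); rewrite inE; apply; apply: map_f; rewrite mem_enum.
Qed.

Lemma hitting_size_le (V : finType) (H : {set {set V}}) (S : {set V}) :
  hitting H S -> hitting_size H <= #|S|.
Proof.
rewrite /hitting_size; have := mem_index_enum S.
elim: (index_enum _) => // S' s IH; rewrite inE big_cons.
case/orP=> [/eqP<- ->|Ss hS]; first exact: geq_minl.
by case: ifP => _; rewrite ?geq_min IH ?orbT.
Qed.

Lemma min_hitting_set (V : finType) (e : rel V) (H : {set {set V}}) :
  thicket e H -> exists X, [/\ hitting H X, #|X| <= hitting_size H &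
    forall S, hitting H S -> #|X| <= #|S|].
Proof.
case=> HC _; have hT : hitting H setT.
  by apply/hittingP => X /HC[X0 _]; rewrite setTI.
case: (arg_minnP (fun S : {set V} => #|S|) hT) => X hX XP.
exists X; split=> //; rewrite /hitting_size.
(* The default value [#|V|] also bounds the size of [X] from above. *)
elim/big_ind: _ => [|m n Xm Xn|S hS]; [exact: max_card| |exact: XP].
by rewrite leq_min Xm.
Qed.

Lemma thicket_holdsP (V : finType) (e : rel V) (H : {set {set V}}) :
  reflect (thicket e H) (thicket_holds e H).
Proof.
by rewrite /thicket_holds; case: excluded_middle_informative => h; constructor.
Qed.

Lemma has_vine_width_bP (V : finType) (e : rel V) k :
  reflect (has_vine_width e k) (has_vine_width_b e k).
Proof.
by rewrite /has_vine_width_b; case: excluded_middle_informative => h; constructor.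
Qed.

Lemma thicket_number_le_vinewidth (V : finType) (e : rel V) :
  thicket_number e <= vinewidth e.
Proof.
rewrite /vinewidth; case: ex_minnP => k /has_vine_width_bP[T [r [l [D <-]]]] _.
apply/bigmax_leqP => H /thicket_holdsP Hth.
have [t ht] := thicket_bag_hitting D Hth.
by apply: leq_trans (hitting_size_le ht) _; apply: (leq_bigmax t).
Qed.

(** * Decompositions of induced subgraphs and their gluing *)

(** A vine decomposition of the subgraph induced by [U], kept on the type [V] to avoid subtypes of
    vertices. *)
Definition vine_on (V : finType) (e : rel V) (U : {set V})
    (T : finType) (r : rel T) (l : T -> {set V}) : Prop :=
  [/\ is_tree r,
      forall v, v \in U -> node_set l v != set0 /\ connected_in r (node_set l v),
      forall u v, u \in U -> v \in U -> e u v ->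
        exists t t', [/\ t \in node_set l u, t' \in node_set l v &
                         (t == t') || r t t'] &
      forall t, l t \subset U].

(** The node [s] is where decompositions get joined. Bags missing some member of [H] may have any
    size. *)
Definition admissible (V : finType) (e : rel V) (k : nat) (H : {set {set V}})
    (X U : {set V}) : Prop :=
  exists (T : finType) (r : rel T) (l : T -> {set V}) (s : T),
    [/\ vine_on e U r l, l s = X & forall t, hitting H (l t) -> #|l t| <= k].

Lemma connect_homo (T T' : finType) (r : rel T) (r' : rel T') (f : T -> T') x y :
  (forall u v, r u v -> connect r' (f u) (f v)) ->
  connect r x y -> connect r' (f x) (f y).
Proof.
move=> rf /connectP[p pp ->] {y}; elim: p x pp => [|z p IH] x /=.
  by rewrite connect0.
by case/andP=> /rf xz /IH; apply: connect_trans.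
Qed.

(** The nodes [s1] and [s2] are joined by an edge rather than identified, so the nodes form a plain
    sum type. *)
Definition tree_glue (T1 T2 : finType) (r1 : rel T1) (r2 : rel T2)
    (s1 : T1) (s2 : T2) : rel (T1 + T2) :=
  fun x y => match x, y with
    | inl a, inl b => r1 a b
    | inr a, inr b => r2 a b
    | inl a, inr b | inr b, inl a => (a == s1) && (b == s2)
    end.

Lemma is_tree_glue (T1 T2 : finType) (r1 : rel T1) (r2 : rel T2) s1 s2 :
  is_tree r1 -> is_tree r2 -> is_tree (tree_glue r1 r2 s1 s2).
Proof.
move=> rT1 rT2; have rB1 := is_tree_bridges rT1; have rB2 := is_tree_bridges rT2.
case: rT1 => [[rC1 rI1] [_ [rK1 _]]]; case: rT2 => [[rC2 rI2] [_ [rK2 _]]].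
have gC : symmetric (tree_glue r1 r2 s1 s2) by move=> [a|a] [b|b] /=.
apply: is_tree_of_bridges.
- by split=> // -[a|a] /=.
- by apply/card_gt0P; exists (inl s1).
- have gP x : connect (tree_glue r1 r2 s1 s2) (inl s1) x.
    case: x => a.
      by apply: connect_homo (rK1 s1 a) => u v ruv; apply: connect1.
    apply: (connect_trans (y := inr s2)).
      by apply: connect1; rewrite /= !eqxx.
    by apply: connect_homo (rK2 s2 a) => u v ruv; apply: connect1.
  move=> x y; apply: (connect_trans (y := inl s1)) => //.
  by rewrite (sym_connect_sym gC).
(* Without the joining edge, the side of the sum is constant along walks. *)
have across a b : ~ connect (edge_del (tree_glue r1 r2 s1 s2) (inl s1) (inr s2))
    (inl a) (inr b).
  move=> /(connect_homo (r' := eq_op)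
    (f := fun x : T1 + T2 => if x is inl _ then true else false)) h.
  have /h/connectP[p]: forall u v : T1 + T2,
      edge_del (tree_glue r1 r2 s1 s2) (inl s1) (inr s2) u v ->
      connect eq_op (if u is inl _ then true else false)
                    (if v is inl _ then true else false).
    move=> [u|u] [v|v]; rewrite ?connect0 // /edge_del /=.
      by case/andP=> /andP[/eqP-> /eqP->]; rewrite !eqxx.
    by case/andP=> /andP[/eqP-> /eqP->]; rewrite !eqxx.
  by elim: p {a b h} => [|[] p IH].
move=> [a|a] [b|b] /= rab.
(* Collapsing the second tree onto [s1] turns a walk bypassing [a b] into one in the first tree. *)
- pose f (x : T1 + T2) := if x is inl a then a else s1.
  move=> /(connect_homo (r' := edge_del r1 a b) (f := f)) h.
  apply: (rB1 _ _ rab); apply: h => -[u|u] [v|v] //=.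
  + by move=> h; apply: connect1.
  + by case/andP=> /andP[/eqP-> _].
  + by case/andP=> /andP[/eqP-> _].
- by case/andP: rab => /eqP-> /eqP->; apply: across.
- case/andP: rab => /eqP-> /eqP-> h; apply: (across s1 s2).
  rewrite (sym_connect_sym (e := edge_del _ _ _)).
    apply: connect_sub h => u v /andP[guv huv]; apply: connect1.
    by rewrite /edge_del guv orbC.
  by move=> u v; rewrite /edge_del gC; congr (_ && ~~ _); rewrite orbC !(andbC (u == _)).
- pose f (x : T1 + T2) := if x is inr a then a else s2.
  move=> /(connect_homo (r' := edge_del r2 a b) (f := f)) h.
  apply: (rB2 _ _ rab); apply: h => -[u|u] [v|v] //=.
  + by case/andP=> /andP[_ /eqP->].
  + by case/andP=> /andP[_ /eqP->].
  + by move=> h; apply: connect1.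
Qed.

Lemma admissible_base (V : finType) (e : rel V) k H (X : {set V}) :
  #|X| <= k -> admissible e k H X X.
Proof.
move=> Xk; exists unit, (fun _ _ => false), (fun _ => X), tt; split=> //; split=> //.
- apply: is_tree_of_bridges => //; first by rewrite card_unit.
  by move=> [] []; exact: connect0.
- move=> v vX; split; first by apply/set0Pn; exists tt; rewrite inE.
  by move=> [] [] _ _; exact: connect0.
by move=> u v uX vX _; exists tt, tt; rewrite !inE.
Qed.

(** A vertex on both sides lies in [X], hence in the bags at [s1] and [s2], so its two subtrees are
    linked by the new edge. An edge between the sides has an end in [X], so both its ends lie on one
    side. *)
Lemma admissible_glue (V : finType) (e : rel V) k H (X U1 U2 : {set V}) :
  symmetric e -> admissible e k H X U1 -> admissible e k H X U2 ->
  U1 :&: U2 \subset X ->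
  (forall u v, u \in U1 -> v \in U2 -> e u v -> (u \in X) || (v \in X)) ->
  admissible e k H X (U1 :|: U2).
Proof.
move=> eC [T1 [r1 [l1 [s1 [[rT1 lC1 lE1 lU1] ls1 lk1]]]]].
move=> [T2 [r2 [l2 [s2 [[rT2 lC2 lE2 lU2] ls2 lk2]]]]] sX sE.
have XU1 : X \subset U1 by rewrite -ls1.
have XU2 : X \subset U2 by rewrite -ls2.
pose g := tree_glue r1 r2 s1 s2.
pose l (x : T1 + T2) := match x with inl a => l1 a | inr b => l2 b end.
have gC : symmetric g by case: (is_tree_glue s1 s2 rT1 rT2) => [[]].
have in1 v a b : v \in l1 a -> v \in l1 b ->
    connect (restr g (node_set l v)) (inl a) (inl b).
  move=> va vb; have [_ cv] := lC1 v (subsetP (lU1 a) v va).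
  have: connect (restr r1 (node_set l1 v)) a b by apply: cv; rewrite inE.
  apply: connect_homo => x y /and3P[vx vy rxy]; apply: connect1.
  by rewrite !inE in vx vy; rewrite /restr !inE vx vy.
have in2 v a b : v \in l2 a -> v \in l2 b ->
    connect (restr g (node_set l v)) (inr a) (inr b).
  move=> va vb; have [_ cv] := lC2 v (subsetP (lU2 a) v va).
  have: connect (restr r2 (node_set l2 v)) a b by apply: cv; rewrite inE.
  apply: connect_homo => x y /and3P[vx vy rxy]; apply: connect1.
  by rewrite !inE in vx vy; rewrite /restr !inE vx vy.
have in12 v a b : v \in l1 a -> v \in l2 b ->
    connect (restr g (node_set l v)) (inl a) (inr b).
  move=> va vb; have vX : v \in X.
    by rewrite (subsetP sX) // inE (subsetP (lU1 a)) // (subsetP (lU2 b)).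
  apply: (connect_trans (y := inl s1)); first by apply: in1; rewrite // ls1.
  apply: (connect_trans (y := inr s2)); last by apply: in2; rewrite // ls2.
  by apply: connect1; rewrite /restr !inE /= ls1 ls2 vX !eqxx.
exists (T1 + T2)%type, g, l, (inl s1); split=> //; last by case.
split.
- exact: is_tree_glue.
- move=> v vU; split.
    case/setUP: vU => [/lC1|/lC2] [/set0Pn[t]]; rewrite inE => vt _; apply/set0Pn.
      by exists (inl t); rewrite inE.
    by exists (inr t); rewrite inE.
  move=> [a|a] [b|b]; rewrite !inE /= => va vb; [exact: in1|exact: in12| |exact: in2].
  by rewrite connect_restrC //; exact: in12.
- have both1 u v : u \in U1 -> v \in U1 -> e u v ->
      exists t t', [/\ t \in node_set l u, t' \in node_set l v & (t == t') || g t t'].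
    move=> uU vU /(lE1 _ _ uU vU)[t [t' [ut vt tt']]].
    by exists (inl t), (inl t'); rewrite !inE in ut vt *; split.
  have both2 u v : u \in U2 -> v \in U2 -> e u v ->
      exists t t', [/\ t \in node_set l u, t' \in node_set l v & (t == t') || g t t'].
    move=> uU vU /(lE2 _ _ uU vU)[t [t' [ut vt tt']]].
    by exists (inr t), (inr t'); rewrite !inE in ut vt *; split.
  move=> u v /setUP[uU|uU] /setUP[vU|vU] euv; auto.
  + have /orP[uX|vX] := sE u v uU vU euv.
      by apply: both2 => //; apply: (subsetP XU2).
    by apply: both1 => //; apply: (subsetP XU1).
  + have /orP[vX|uX] := sE v u vU uU ltac:(by rewrite eC).
      by apply: both2 => //; apply: (subsetP XU2).
    by apply: both1 => //; apply: (subsetP XU1).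
case=> t /=; [exact: subset_trans (lU1 t) (subsetUl _ _)|].
exact: subset_trans (lU2 t) (subsetUr _ _).
Qed.

(** * Components of G - X *)

(** Meant for [x] outside [X]; for [x] in [X] the set is just {x}. *)
Definition component (V : finType) (e : rel V) (X : {set V}) (x : V) : {set V} :=
  [set y | connect (restr e (~: X)) x y].

Lemma component_notin (V : finType) (e : rel V) (X : {set V}) x y :
  x \notin X -> y \in component e X x -> y \notin X.
Proof. by move=> xX; rewrite inE -!in_setC in xX * => /(connect_restr_in xX). Qed.

Lemma component_closed (V : finType) (e : rel V) (X : {set V}) x y z :
  x \notin X -> y \in component e X x -> e y z -> z \notin X ->
  z \in component e X x.
Proof.
move=> xX yC eyz zX; have yX := component_notin xX yC.
rewrite inE in yC; rewrite inE; apply: connect_trans yC (connect1 _).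
by rewrite /restr !inE yX zX.
Qed.

(** The last hypothesis makes U \ X a union of components. Removing one of them from [U] preserves
    it, and only [X] separates that component from the rest, so the pieces are glued one at a
    time. *)
Lemma admissible_components (V : finType) (e : rel V) k H (X U : {set V}) :
  symmetric e -> #|X| <= k ->
  (forall x, x \notin X -> admissible e k H X (X :|: component e X x)) ->
  X \subset U ->
  (forall u v, u \in U -> u \notin X -> e u v -> v \in U) ->
  admissible e k H X U.
Proof.
move=> eC Xk aC; have [n] := ubnP #|U|; elim: n U => // n IH U sU XU Ucl.
have [UX|] := boolP (U \subset X).
  have -> : U = X by apply/eqP; rewrite eqEsubset UX.
  exact: admissible_base.
case/subsetPn=> x xU xX; set C := component e X x.
have xC : x \in C by rewrite inE connect0.
have CX y : y \in C -> y \notin X by apply: component_notin.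
have CU : C \subset U.
  apply/subsetP=> y; rewrite inE => /connectP[p pp ->].
  elim: p x xU {xX C xC CX} pp => //= z p IHp x xU.
  case/andP=> /and3P[]; rewrite inE => xX _ xz; apply: IHp; exact: Ucl xz.
have -> : U = (U :\: C) :|: (X :|: C).
  apply/setP=> y; rewrite !in_setU in_setD.
  have [yC|yC] /= := boolP (y \in C); first by rewrite (subsetP CU) // orbT.
  by rewrite orbF; have [/(subsetP XU)->|] := boolP (y \in X); rewrite ?orbF.
apply: admissible_glue => //; [|exact: aC| |].
- apply: IH.
  + rewrite -ltnS; apply: leq_trans sU; rewrite !ltnS; apply: proper_card.
    by apply/properP; split; [exact: subsetDl | exists x; rewrite // !inE connect0].
  + apply/subsetP=> y yX; rewrite in_setD (subsetP XU) // andbT.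
    by apply: contraL yX; apply: CX.
  + move=> u v /setDP[uU uC] uX euv; rewrite in_setD (Ucl u) // andbT.
    by apply: contra uC => vC; apply: component_closed vC _ uX; rewrite // eC.
- apply/subsetP=> y; rewrite in_setI in_setD in_setU.
  by case/andP=> /andP[/negPf->]; rewrite orbF.
- move=> u v /setDP[uU uC] /setUP[->|vC]; rewrite ?orbT // => euv.
  apply/orP; left; apply: contraNT uC => uX.
  by apply: component_closed vC _ uX; rewrite // eC.
Qed.

(** * Decompositions around one component of G - X *)

(** A walk in [Y] from [v] to [X] cannot enter [C] before meeting [X]. [P] is the component of [v]
    in Y \ C. *)
Lemma connected_in_avoid (V : finType) (e : rel V) (X C Y : {set V}) v :
  symmetric e ->
  (forall y z, y \in C -> e y z -> z \notin X -> z \in C) ->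
  connected_in e Y -> X :&: Y != set0 -> v \in Y -> v \notin C ->
  exists P : {set V}, [/\ P \subset Y :\: C, connected_in e P, v \in P &
                          X :&: P != set0].
Proof.
move=> eC Ccl cY /set0Pn[x /setIP[xX xY]] vY vC.
exists [set w | connect (restr e (Y :\: C)) v w]; split.
- apply/subsetP=> w; rewrite inE; apply: connect_restr_in.
  by rewrite inE vC.
- exact: connected_in_component.
- by rewrite inE connect0.
have /connectP[p pp xE] := cY v x vY xY; rewrite {}xE {x xY} in xX.
elim: p v vY vC pp xX => [|w p IH] v vY vC /=.
  by move=> _ vX; apply/set0Pn; exists v; rewrite !inE vX connect0.
case/andP=> /and3P[_ wY evw] pp lX.
have [vX|vX] := boolP (v \in X).
  by apply/set0Pn; exists v; rewrite !inE vX connect0.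
have wC : w \notin C by apply: contra vC => wC; apply: (Ccl w) vX => //; rewrite eC.
have /set0Pn[x] := IH w wY wC pp lX; rewrite !inE => /andP[xX wx].
apply/set0Pn; exists x; rewrite !inE xX /=; apply: connect_trans wx.
by apply: connect1; rewrite /restr !inE vC vY wC wY.
Qed.

(* Each x in X is added to the bags between a node holding x and s. That bags do
   not grow follows from the minimality of X: the vertices Q t added at t cannot
   outnumber the vertices R of [l t] outside X and C, because (X \ Q t) u R
   still hits H. *)
Lemma admissible_restrict (V : finType) (e : rel V) k (H : {set {set V}})
    (X C : {set V}) (T : finType) (r : rel T) (l : T -> {set V}) s :
  symmetric e -> thicket e H -> hitting H X ->
  (forall S, hitting H S -> #|X| <= #|S|) -> #|X| <= k ->
  (forall y, y \in C -> y \notin X) ->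
  (forall y z, y \in C -> e y z -> z \notin X -> z \in C) ->
  vine_decomposition e r l ->
  (forall t, hitting (C |: H) (l t) -> #|l t| <= k) ->
  hitting H (l s) -> l s :&: C = set0 ->
  admissible e k H X (X :|: C).
Proof.
move=> eC [HC _] hX Xmin Xk CX Ccl D lk hs sC; have [rT [lC lE]] := D.
(* [M x] is the tree path to [s] from some node whose bag holds [x]. *)
have /fin_all_exists[M MP] : forall x : V, exists M : {set T},
    [/\ node_set l x :&: M != set0, s \in M, connected_in r M &
        forall A, connected_in r A -> node_set l x \subset A -> s \in A ->
        M \subset A].
  move=> x; have [/set0Pn[a ax] _] := lC x.
  have [M [aM sM cM MA]] := tree_segment a s rT.
  exists M; split=> //; first by apply/set0Pn; exists a; rewrite inE ax.
  by move=> A cA /subsetP xA; apply: MA => //; exact: xA.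
(* The nodes whose bags meet [Y] form a subtree containing [s] and all nodes holding [x], hence also
   [M x]. *)
have MY x t Y : connected_in e Y -> x \in Y -> l s :&: Y != set0 -> t \in M x ->
    l t :&: Y != set0.
  move=> cY xY sY tM; case: (MP x) => _ _ _ MA.
  have := MA _ (connected_in_bags D cY); rewrite !inE sY => /(_ _ isT).
  move=> /(_ _)/subsetP/(_ t tM); rewrite inE; apply.
  apply/subsetP=> t'; rewrite !inE => xt'.
  by apply/set0Pn; exists x; rewrite inE xt'.
pose l' t := l t :&: (X :|: C) :|: [set x in X | t \in M x].
pose Q t := [set x in X | t \in M x & x \notin l t].
have l'E t : l' t = l t :&: (X :|: C) :|: Q t.
  apply/setP=> x; rewrite !inE.
  by case: (x \in l t); case: (x \in X); rewrite //= ?andbT ?andbF ?orbT.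
have Q_le t : #|Q t| <= #|l t :\: (X :|: C)|.
  have QX : Q t \subset X by apply/subsetP=> x; rewrite inE => /andP[].
  (* If this set missed [Y], a connected part [P] of Y \ C would join a vertex of [l s] to some x in
     [Q t]. Then [t] is in [M x], so [l t] meets [P] in some w outside [C]. As w is in [l t], it is
     not in [Q t], so it lies in the set after all. *)
  have hZ : hitting H ((X :\: Q t) :|: (l t :\: (X :|: C))).
    apply/hittingP=> Y YH; apply/negP=> /eqP Z0.
    have ZF y : y \in Y -> y \notin (X :\: Q t) :|: (l t :\: (X :|: C)).
      move=> yY; apply/negP=> yZ; have := in_set0 y.
      by rewrite -Z0 inE yZ yY.
    have /set0Pn[v /setIP[vs vY]] := hittingP _ _ hs Y YH.
    have vC : v \notin C.
      by apply/negP=> vC; have := in_set0 v; rewrite -sC inE vs vC.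
    have [P [PY cP vP /set0Pn[x /setIP[xX xP]]]] :=
      connected_in_avoid eC Ccl (HC Y YH).2 (hittingP _ _ hX Y YH) vY vC.
    have /setDP[xY xC] := subsetP PY x xP.
    have := ZF x xY; rewrite !inE xX /= orbF andbT negbK => /andP[tM _].
    have sP : l s :&: P != set0 by apply/set0Pn; exists v; rewrite inE vs.
    have /set0Pn[w /setIP[wt wP]] := MY x t P cP xP sP tM.
    have /setDP[wY wC] := subsetP PY w wP.
    by have := ZF w wY; rewrite !inE wt (negPf wC) !andbF; case: (w \in X).
  have := leq_trans (Xmin _ hZ) (leq_card_setU _ _).
  by rewrite -{1}(cardsID (Q t) X) (setIidPr QX) addnC leq_add2l.
have l'_le t : #|l' t| <= #|l t|.
  rewrite l'E -(cardsID (X :|: C) (l t)).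
  by apply: leq_trans (leq_card_setU _ _) _; rewrite leq_add2l.
have nE x : node_set l' x = if x \in X then node_set l x :|: M x
    else if x \in C then node_set l x else set0.
  apply/setP=> t; rewrite !inE.
  by case: ifP => xX; [|case: ifP => xC]; rewrite ?inE ?xX /= ?andbT ?andbF ?orbF.
have sub_l' x : x \in X :|: C -> node_set l x \subset node_set l' x.
  rewrite nE inE; case: ifP => _ /=; first by rewrite subsetUl.
  by move=> ->.
exists T, r, l', s; split.
- split=> //.
  + move=> v vU; split.
      have [/set0Pn[t tv] _] := lC v; apply/set0Pn; exists t.
      exact: (subsetP (sub_l' v vU)).
    rewrite nE; case: ifP => vX; last first.
      by move: vU; rewrite inE vX /= => ->; apply: (lC v).2.
    have [h _ cM _] := MP v; apply: connected_inU => //; last exact: (lC v).2.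
    by case: rT => [[]].
  + move=> u v uU vU /lE[t [t' [ut vt tt']]]; exists t, t'; split=> //.
      exact: (subsetP (sub_l' u uU)).
    exact: (subsetP (sub_l' v vU)).
  + move=> t; rewrite l'E subUset subsetIr; apply/subsetP=> x.
    by rewrite !inE => /andP[->].
(* Every [M x] contains [s], and [l s] misses [C], so the bag at [s] is exactly [X]. *)
- apply/setP=> x; rewrite !inE; have [_ sM _ _] := MP x; rewrite sM andbT.
  have [//|xX] := boolP (x \in X); first by rewrite orbT.
  by have := in_set0 x; rewrite -sC inE orbF.
move=> t hl'; rewrite leqNgt; apply/negP=> kl'.
(* A new bag that is too large comes from an old one that is too large, which therefore misses [C]
   or a member of [H]. *)
have : ~~ hitting (C |: H) (l t).
  by apply: contraL (leq_trans kl' (l'_le t)) => /lk; rewrite -leqNgt.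
case/forall_inPn=> Y YCH /negPn/eqP lY.
have YF y : y \in l t -> y \notin Y.
  by move=> yt; apply/negP=> yY; have := in_set0 y; rewrite -lY inE yt yY.
move: YCH; rewrite in_setU1 => /orP[/eqP YC|YH].
  suff l'X : l' t \subset X.
    by move: kl'; rewrite ltnNge (leq_trans (subset_leq_card l'X)).
  apply/subsetP=> x; rewrite !inE; case/orP=> [|/andP[]//].
  by case/andP=> /YF; rewrite YC => /negPf->; rewrite orbF.
(* The new bag meets [Y] in an added vertex x of [X]; then [t] is in [M x], so [l t] meets [Y] as
   well. *)
have /set0Pn[x /setIP[]] := hittingP _ _ hl' Y YH.
rewrite !inE => /orP[/andP[/YF/negPf->]//|/andP[xX tM] xY].
have := MY x t Y (HC Y YH).2 xY (hittingP _ _ hs Y YH) tM.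
by rewrite lY eqxx.
Qed.

(** The bag [C] misses [Y], so its size is unrestricted. As [X] and [C] are disjoint, each vertex
    lives at a single node. *)
Lemma admissible_miss (V : finType) (e : rel V) k (H : {set {set V}})
    (X C Y : {set V}) :
  #|X| <= k -> (forall y, y \in C -> y \notin X) -> connected_in e C ->
  Y \in H -> C :&: Y = set0 -> admissible e k H X (X :|: C).
Proof.
move=> Xk CX cC YH CY.
have K2 : is_tree (fun x y : bool => x != y).
  apply: is_tree_of_bridges => //.
  - by split=> [x y|x]; rewrite ?eqxx // eq_sym.
  - by rewrite card_bool.
  - by move=> [] []; rewrite ?connect0 //; apply: connect1.
  move=> a b ab /connectP[[|c p]] /=; first by move=> _ E; rewrite E eqxx in ab.
  by case: a b c ab => [] [] [].
exists bool, (fun x y => x != y), (fun b : bool => if b then X else C), true.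
split=> //; last first.
  by case=> // /hittingP/(_ Y YH); rewrite CY eqxx.
split=> //.
- move=> v; rewrite inE => vXC; split.
    by apply/set0Pn; case/orP: vXC => h; [exists true|exists false]; rewrite inE.
  move=> [] []; rewrite !inE ?connect0 // => v1 v2; last first.
    by rewrite (negPf (CX v v1)) in v2.
  by rewrite (negPf (CX v v2)) in v1.
- move=> u v; rewrite !inE => uU vU _.
  by case/orP: uU => hu; case/orP: vU => hv;
    [exists true, true|exists true, false|exists false, true|exists false, false];
    rewrite !inE.
- by case; rewrite ?subsetUl ?subsetUr.
Qed.

(** * The duality *)

Lemma thicket_vine_decomposition (V : finType) (e : rel V) k (H : {set {set V}}) :
  symmetric e -> (forall H', thicket e H' -> hitting_size H' <= k) ->
  thicket e H ->
  exists (T : finType) (r : rel T) (l : T -> {set V}),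
    vine_decomposition e r l /\ forall t, hitting H (l t) -> #|l t| <= k.
Proof.
(* The measure is the number of vertex sets outside [H]. *)
move=> eC ek; have [n] := ubnP #|~: H|; elim: n H => // n IH H sH Hth.
have [X [hX Xs Xmin]] := min_hitting_set Hth.
have Xk := leq_trans Xs (ek H Hth).
(* Arguing by contradiction allows stopping inside the case of a single component, should a
   decomposition found there already serve [H]. *)
apply: NNPP => noD; have [||//|T [r [l [s [[rT lC lE lU] _ lk]]]]] :=
    @admissible_components V e k H X setT eC Xk; last first.
- apply: noD; exists T, r, l; do 3?split=> //.
    by move=> v; apply: lC; rewrite inE.
  by move=> u v; apply: lE; rewrite inE.
- exact: subsetT.
move=> x xX; set C := component e X x.
have CX y : y \in C -> y \notin X by apply: component_notin.
have Ccl y z : y \in C -> e y z -> z \notin X -> z \in C by apply: component_closed.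
have cC : connected_in e C by apply: connected_in_component.
have C0 : C != set0 by apply/set0Pn; exists x; rewrite inE connect0.
have [/exists_inP[Y YH /eqP CY]|] := boolP [exists Y in H, C :&: Y == set0].
  exact: admissible_miss YH CY.
rewrite negb_exists_in => /forall_inP hC.
(* [X] hits every member of [H] but not [C], so adding [C] decreases the measure. *)
have CH : C \notin H.
  apply/negP=> CH; have /set0Pn[y /setIP[yX yC]] := hittingP _ _ hX C CH.
  by move: (CX y yC); rewrite yX.
have CHth : thicket e (C |: H).
  have [HC HI] := Hth; split=> [Y|Y Z]; rewrite !in_setU1.
    by case/orP=> [/eqP->|/HC].
  case/orP=> [/eqP->|YH] /orP[/eqP->|ZH]; first by rewrite setIid.
  - exact: hC.
  - by rewrite setIC hC.
  - exact: HI.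
have [||T [r [l [D lk]]]] := IH (C |: H) => //.
  rewrite -ltnS; apply: leq_trans sH; rewrite !ltnS; apply: proper_card.
  rewrite properE !setCS subsetUr /= subUset sub1set negb_and CH //.
have [/forall_inP h|] := boolP [forall t in [pred t | hitting H (l t)], #|l t| <= k].
  by case: noD; exists T, r, l.
(* The bag at [s] hits [H] and is too large, so by the choice of [l] it must miss [C]. *)
case/forall_inPn=> s; rewrite inE => hs ks.
apply: (admissible_restrict (s := s) _ _ _ _ _ _ _ D lk hs) => //.
apply/eqP; apply: contraNT ks => sC; apply: lk; apply/hittingP=> Y.
by rewrite in_setU1 => /orP[/eqP->|]//; apply/hittingP.
Qed.

Lemma vinewidth_le_thicket_number (V : finType) (e : rel V) :
  symmetric e -> vinewidth e <= thicket_number e.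
Proof.
move=> eC.
have [||T [r [l [D lk]]]] :=
    @thicket_vine_decomposition V e (thicket_number e) set0 eC.
- by move=> H /thicket_holdsP Hth; apply: (leq_bigmax_cond (P := thicket_holds e)).
- by split=> [X|X Y]; rewrite inE.
rewrite /vinewidth; case: ex_minnP => k _ kmin.
apply: leq_trans (kmin (width l) _) _.
  by apply/has_vine_width_bP; exists T, r, l.
(* Every bag hits the empty thicket. *)
by apply/bigmax_leqP => t _; apply: lk; apply/hittingP => X; rewrite inE.
Qed.

Theorem theorem2p5 (V : finType) (e : rel V) :
  simple_graph e -> 0 < #|V| -> thicket_number e = vinewidth e.
Proof.
move=> [eC _] _; apply/eqP; rewrite eqn_leq thicket_number_le_vinewidth.
exact: vinewidth_le_thicket_number.
Qed.
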